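(* Let $F$ be a free group of finite rank $n$ with free basis $X$. (1) Let $H$ be a supnormal subgroup of $F$, i.e. $H$ contains a non-trivial subgroup which is normal in $F$, and let $\mathcal T$ be a Schreier transversal for $H$ in $F$. Then $r_{\mathcal T}(i)\sim\Gamma_{\mathcal T}(i)$. (2) More generally, let $H$ be a subgroup of $F$ (not necessarily supnormal) such that $|F:N_F(A)|<\infty$ for some non-trivial subgroup $A$ of $H$, where $N_F(A)$ is the normalizer of $A$ in $F$. Then $rk_H(i)\sim\Gamma_{F/H}(i)$.
   Context: A Schreier transversal for $H$ in $F$ is a set $\mathcal T$ of representatives of the right cosets $Hg$ of $H$ in $F$, written as reduced words in $X\cup X^{-1}$, containing $1$ (representing $H$) and such that every initial segment of an element of $\mathcal T$ is in $\mathcal T$. It is minimal if moreover every coset is represented by an element of minimal length in that coset. Here $l(v)$ denotes the length of $v\in F$ as a reduced word over $X\cup X^{-1}$. Put $\gamma_{\mathcal T}(i)=|\{v\in\mathcal T: l(v)=i\}|$, $\Gamma_{\mathcal T}(i)=|\{v\in\mathcal T: l(v)\le i\}|$ and $$r_{\mathcal T}(i)=1+(n-1)\Gamma_{\mathcal T}(i)-\tfrac12\gamma_{\mathcal T}(i+1).$$ The cogrowth function $\Gamma_{F/H}$ of $H$ is $\Gamma_{\mathcal T}$ for a minimal Schreier transversal $\mathcal T$ of $H$ (it does not depend on which minimal one is chosen). The rank-growth function of $H$ is $rk_H(i)=\operatorname{rank}(H_i)$, where $H_i$ is the subgroup generated by $\{h\in H: l(h)\le i\}$. For non-decreasing non-negative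 functions $f_1,f_2$, $f_1(i)\preceq f_2(i)$ means that there is a positive integer $c$ such that $f_1(i)\le c\,f_2(ci)$ for all integers $i\ge1$; and $f_1\sim f_2$ means $f_1\preceq f_2$ and $f_2\preceq f_1$. *)

(* Defs.v *)
From HB Require Import structures.
From mathcomp Require Import all_boot all_order all_algebra.
From mathcomp Require Import finmap.
From mathcomp Require Import boolp classical_sets functions cardinality.

Set Implicit Arguments.
Unset Strict Implicit.
Unset Printing Implicit Defensive.

Import GRing.Theory Num.Theory.

Local Open Scope classical_set_scope.
Local Open Scope group_scope.

Section Subgroups.
Variable F : groupType.
Implicit Types (A H K N S : set F) (g h : F).

Definition subgroup H : Prop := group_closed (mem H).

Definition generated S : set F := smallest subgroup S.

Definition nontrivial H : Prop := exists2 h, H h & h <> 1.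

Definition conj_set A g : set F := [set a ^ g | a in A].

Definition normal_in_whole N : Prop :=
  subgroup N /\ forall g, conj_set N g = N.

Definition supnormal H : Prop :=
  subgroup H /\ exists N, [/\ normal_in_whole N, nontrivial N & N `<=` H].

Definition normalizer A : set F := [set g | conj_set A g = A].

Definition right_coset H g : set F := [set h * g | h in H].

Definition finite_index H : Prop := finite_set (range (right_coset H)).

End Subgroups.

(* The letter (i, false) stands for the generator x i, and (i, true) for its
   inverse. *)
Definition word (k : nat) : Type := seq ('I_k * bool).

Definition inv_letter (k : nat) (a : 'I_k * bool) : 'I_k * bool :=
  (a.1, ~~ a.2).

Definition reduced (k : nat) (w : word k) : bool :=
  sorted (fun a b => b != inv_letter a) w.

Definition eval_word (F : groupType) (k : nat) (x : 'I_k -> F) (w : word k) : F :=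
  \prod_(a <- w) (if a.2 then (x a.1)^-1 else x a.1).

(* The second clause forces x to be injective: if x i = x j with i <> j then
   the reduced word x_i x_j^-1 evaluates to 1. *)
Definition free_basis (F : groupType) (k : nat) (x : 'I_k -> F) (G : set F) :
    Prop :=
  generated (range x) = G /\
  forall w : word k, reduced w -> eval_word x w = 1 -> w = [::].

(* Subgroups of a free group are free and any two free bases have the same
   cardinality; the default value 0 is only taken when G has no finite free
   basis. *)
Definition rank (F : groupType) (G : set F) : nat :=
  xget 0%N [set k | exists y : 'I_k -> F, free_basis y G].

Section FreeGroup.
Variables (F : groupType) (n : nat) (x : 'I_n -> F).
Implicit Types (H T : set F) (g v : F) (i : nat).

(* When x is a free basis of F, every v has exactly one such word. *)
Definition reduced_word v : word n :=
  xget [::] [set w : word n | reduced w /\ eval_word x w = v].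

Definition len v : nat := size (reduced_word v).

Definition schreier_transversal H T : Prop :=
  [/\ forall g, exists! t, T t /\ right_coset H g t,
      T 1 &
      forall v j, T v -> T (eval_word x (take j (reduced_word v)))].

Definition minimal_schreier_transversal H T : Prop :=
  schreier_transversal H T /\
  forall t g, T t -> right_coset H t g -> (len t <= len g)%N.

(* The sets counted here are finite, there being finitely many words of a given
   length. *)
Definition sphere_growth T i : nat :=
  #|` fset_set [set v | T v /\ len v = i]|%fset.

Definition ball_growth T i : nat :=
  #|` fset_set [set v | T v /\ (len v <= i)%N]|%fset.

Definition r_growth T i : rat :=
  (1 + (n%:R - 1) * (ball_growth T i)%:R - (sphere_growth T i.+1)%:R / 2)%R.

(* Minimal Schreier transversals exist for every subgroup H, and the value does
   not depend on the one chosen. *)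
Definition cogrowth H i : nat :=
  ball_growth (xget set0 [set T | minimal_schreier_transversal H T]) i.

Definition rank_growth H i : nat :=
  rank (generated [set h | H h /\ (len h <= i)%N]).

End FreeGroup.

Definition growth_le (f1 f2 : nat -> rat) : Prop :=
  exists2 c : nat, (0 < c)%N &
    forall i : nat, (1 <= i)%N -> (f1 i <= c%:R * f2 (c * i)%N)%R.

Definition growth_equiv (f1 f2 : nat -> rat) : Prop :=
  growth_le f1 f2 /\ growth_le f2 f1.

(* Main.v *)
(* The Schreier transversal T is a spanning tree of the Schreier graph of H. Up
   to constants and a rescaling of i, r_T(i) and rank (H_i) are bounded below by
   the number of vertices of the ball of radius i of T that are incident to an
   edge outside T, and above by the size of that ball: for r_T by counting the
   2n half-edges at each vertex, and for rank (H_i) because the Schreier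
   generators are free and those of length at most i generate H_i, by minimality
   of T. It remains to bound the size of a ball of T by the number of such
   vertices in a slightly larger ball. If a ^ g is a conjugate of some a <> 1 of
   A by one of the finitely many representatives g of N_F(A) in F, then for every
   v some v (a ^ g) v^-1 lies in A, hence in H: the path labelled a ^ g from v is
   closed in the Schreier graph, and not null-homotopic, so it leaves T within a
   bounded distance of v. *)
Require Import Defs.
From mathcomp Require Import all_boot all_order all_algebra.
From mathcomp Require Import finmap.
From mathcomp Require Import boolp classical_sets functions cardinality.
From mathcomp Require Import zify lra.

Set Implicit Arguments.
Unset Strict Implicit.
Unset Printing Implicit Defensive.

Import Order.TTheory GRing.Theory Num.Theory.

Local Open Scope classical_set_scope.
Local Open Scope group_scope.

(** * Free reduction of words over an arbitrary alphabet *)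

Section FreeReduction.
Variable K : eqType.
Implicit Types (a b : K * bool) (s u v w : seq (K * bool)).

(** The alphabet is arbitrary because reduction is applied both to words in the basis and to words
    in Schreier generators, indexed by [F * 'I_n]. For [K = 'I_k], [flip] and [freduced] unfold to
    [inv_letter] and [reduced]. *)
Definition flip a : K * bool := (a.1, ~~ a.2).

Definition freduced w : bool := sorted (fun a b => b != flip a) w.

Definition winv w : seq (K * bool) := rev (map flip w).

Definition rstep a s : seq (K * bool) :=
  if s is b :: s' then if b == flip a then s' else a :: s else [:: a].

Definition red w : seq (K * bool) := foldr rstep [::] w.

Lemma flipK : involutive flip.
Proof. by case=> k b; rewrite /flip /= negbK. Qed.

Lemma winv_cons a w : winv (a :: w) = rcons (winv w) (flip a).
Proof. by rewrite /winv /= rev_cons. Qed.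

Lemma winv_rcons w a : winv (rcons w a) = flip a :: winv w.
Proof. by rewrite /winv map_rcons rev_rcons. Qed.

Lemma size_winv w : size (winv w) = size w.
Proof. by rewrite size_rev size_map. Qed.

Lemma freduced_rstep a s : freduced s -> freduced (rstep a s).
Proof.
case: s => [|b s] //= sR; case: eqP => [_|/eqP ba]; first exact: path_sorted sR.
by rewrite /freduced /= ba.
Qed.

Lemma freduced_red w : freduced (red w).
Proof. by elim: w => //= a w; apply: freduced_rstep. Qed.

Lemma rstep_reduced a s : freduced (a :: s) -> rstep a s = a :: s.
Proof. by case: s => //= b s /andP[/negPf->]. Qed.

Lemma red_id w : freduced w -> red w = w.
Proof.
elim: w => //= a w IH aw; rewrite IH; first exact: rstep_reduced.
exact: path_sorted aw.
Qed.

(** Van der Waerden's trick: letters act on reduced words by permutations, which replaces a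
    confluence argument for cancellations. *)
Lemma rstep_flip a s : freduced s -> rstep a (rstep (flip a) s) = s.
Proof.
case: s => [|b s] sR /=; first by rewrite eqxx.
rewrite flipK; case: (b =P a) => [ba|_] /=; last by rewrite eqxx.
by rewrite -ba rstep_reduced.
Qed.

Lemma red_catr u v w : red v = red w -> red (u ++ v) = red (u ++ w).
Proof. by rewrite /red !foldr_cat => ->. Qed.

Lemma red_catl u w : red (u ++ w) = red (red u ++ w).
Proof.
elim: u => //= a u ->; move: (red u) => s.
case: s => [|b s] //=; case: eqP => // -> /=.
by rewrite rstep_flip ?freduced_red.
Qed.

Lemma red_cancel u a v : red (u ++ a :: flip a :: v) = red (u ++ v).
Proof. by apply: red_catr => /=; rewrite rstep_flip ?freduced_red. Qed.

Lemma red_winvl u v : red (u ++ winv v ++ v) = red u.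
Proof.
elim: v u => [|a v IH] u; first by rewrite /= ?cats0.
rewrite winv_cons cat_rcons catA -{2}(flipK a) red_cancel -catA; exact: IH.
Qed.

Lemma size_red w : (size (red w) <= size w)%N.
Proof.
elim: w => //= a w; case: (red w) => [|b s] //= IH.
by case: ifP => _ //=; lia.
Qed.

Lemma freduced_rconsl w a : freduced (rcons w a) -> freduced w.
Proof. by rewrite /freduced -cats1 => /cat_sorted2[]. Qed.

End FreeReduction.

(** * Evaluation of words in a group *)

Section Evaluation.
Variables (F : groupType) (k : nat) (y : 'I_k -> F).
Implicit Types (u v w : word k) (a : 'I_k * bool).

Definition letter a : F := if a.2 then (y a.1)^-1 else y a.1.

Lemma letter_flip a : letter (flip a) = (letter a)^-1.
Proof. by case: a => i [] /=; rewrite /letter /= ?invgK. Qed.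

Lemma eval_nil : eval_word y [::] = 1.
Proof. by rewrite /eval_word big_nil. Qed.

Lemma eval_cons a w : eval_word y (a :: w) = letter a * eval_word y w.
Proof. by rewrite /eval_word big_cons. Qed.

Lemma eval_cat u v : eval_word y (u ++ v) = eval_word y u * eval_word y v.
Proof. by rewrite /eval_word big_cat. Qed.

Lemma eval_rcons w a : eval_word y (rcons w a) = eval_word y w * letter a.
Proof. by rewrite -cats1 eval_cat eval_cons eval_nil mulg1. Qed.

Lemma eval_winv w : eval_word y (winv w) = (eval_word y w)^-1.
Proof.
elim: w => [|a w IH]; first by rewrite eval_nil invg1.
by rewrite winv_cons eval_rcons eval_cons invgM IH letter_flip.
Qed.

Lemma eval_red w : eval_word y (red w) = eval_word y w.
Proof.
elim: w => //= a w; rewrite eval_cons => <-.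
case: (red w) => [|b s] /=; first by rewrite eval_cons.
case: eqP => [->|_]; last by rewrite eval_cons.
by rewrite eval_cons letter_flip mulgA mulgV mul1g.
Qed.

Lemma subgroup_range_eval : subgroup (range (eval_word y)).
Proof.
split; first by rewrite inE; exists [::]; rewrite ?eval_nil.
move=> g h; rewrite !inE => -[u _ <-] [v _ <-].
by exists (u ++ winv v) => //; rewrite eval_cat eval_winv.
Qed.

Lemma generated_rangeE : generated (range y) = range (eval_word y).
Proof.
apply/seteqP; split.
  apply: smallest_sub; first exact: subgroup_range_eval.
  move=> _ [i _ <-]; exists [:: (i, false)] => //.
  by rewrite eval_cons eval_nil mulg1.
move=> _ [w _ <-] S [[S1 SB] yS].
have SV g : S g -> S g^-1.
  by move=> Sg; move: (SB 1 g); rewrite !inE mul1g; rewrite inE in S1; apply.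
have SM g h : S g -> S h -> S (g * h).
  move=> Sg Sh; move: (SB g h^-1); rewrite !inE invgK; apply=> //; exact: SV.
elim: w => [|a w IH]; first by rewrite eval_nil; rewrite inE in S1.
rewrite eval_cons; apply: (SM _ _ _ IH).
by rewrite /letter; case: ifP => _; [apply: SV|]; apply: yS; exists a.1.
Qed.

Definition free_family : Prop :=
  forall w : word k, reduced w -> eval_word y w = 1 -> w = [::].

Hypothesis y_free : free_family.

Lemma red_eval1 w : eval_word y w = 1 -> red w = [::].
Proof. by rewrite -eval_red => /y_free->//; apply: freduced_red. Qed.

(** By freeness [u v^-1] reduces to the empty word; now reduce [u v^-1 v] in two ways. *)
Lemma red_eval u v : eval_word y u = eval_word y v -> red u = red v.
Proof.
move=> uv; have /red_eval1 r1 : eval_word y (u ++ winv v) = 1.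
  by rewrite eval_cat eval_winv uv mulgV.
by rewrite -(red_winvl u v) catA red_catl r1.
Qed.

End Evaluation.

(** * Cardinalities of finite sets *)

Section Counting.
Local Open Scope nat_scope.

Definition cnt (U : choiceType) (A : set U) : nat := #|` fset_set A|%fset.

(** [fset_set] defaults to the empty set; this settles the infinite case in [cnt_inj]. *)
Lemma cnt_infinite (U : choiceType) (A : set U) : ~ finite_set A -> cnt A = 0.
Proof. by move=> Ainf; rewrite /cnt /fset_set; case: pselect. Qed.

Lemma cnt_inj (U V : choiceType) (A : set U) (B : set V) (f : U -> V) :
  finite_set B -> (forall a, A a -> B (f a)) ->
  (forall a b, A a -> A b -> f a = f b -> a = b) -> cnt A <= cnt B.
Proof.
move=> finB AB f_inj; have [finA|/cnt_infinite-> //] := pselect (finite_set A).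
rewrite /cnt -(card_in_imfset imfset_key (f := f) (p := mem (fset_set A))); last first.
  by move=> a b; rewrite /= !in_fset_set // !inE; apply: f_inj.
apply: fsubset_leq_card; apply/fsubsetP => _ /imfsetP[a /= aA ->].
by move: aA; rewrite !in_fset_set // !inE; apply: AB.
Qed.

Lemma cnt_le (U : choiceType) (A B : set U) :
  finite_set B -> A `<=` B -> cnt A <= cnt B.
Proof. by move=> finB AB; apply: (cnt_inj (f := id)). Qed.

Lemma cnt_surj (U V : choiceType) (A : set U) (B : set V) (f : U -> V) :
  finite_set A -> B `<=` f @` A -> (cnt B <= cnt A)%N.
Proof.
move=> finA BfA; apply: leq_trans (cnt_le (finite_image f finA) BfA) _.
by rewrite /cnt fset_set_image // leq_imfset_card.
Qed.

Lemma cntU (U : choiceType) (A B : set U) :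
  finite_set A -> finite_set B -> A `&` B = set0 ->
  cnt (A `|` B) = cnt A + cnt B.
Proof.
move=> finA finB AB0; rewrite /cnt fset_setU // cardfsU -fset_setI // AB0.
by rewrite fset_set0 cardfs0 subn0.
Qed.

Lemma cntX (U V : choiceType) (A : set U) (B : set V) :
  finite_set A -> finite_set B -> cnt (A `*` B) = cnt A * cnt B.
Proof.
move=> finA finB; rewrite /cnt -(size_allpairs pair).
apply/perm_size/uniq_perm; first exact: fset_uniq.
  by apply: allpairs_uniq => [||[a b] [c d]]; rewrite ?fset_uniq.
move=> [a b]; rewrite in_fset_set; last exact: finite_setX.
apply/idP/allpairsP => [|[[c d] /= [cA dB [-> ->]]]]; rewrite !inE.
  by move=> [/= Aa Bb]; exists (a, b); rewrite /= !in_fset_set ?inE.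
by move: cA dB; rewrite !in_fset_set ?inE.
Qed.

Lemma cnt_finType (U : finType) (A : set U) : cnt A <= #|U|.
Proof. by rewrite cardT uniq_leq_size ?fset_uniq // => a; rewrite mem_enum. Qed.

Lemma cnt1 (U : choiceType) (a : U) : cnt [set a] = 1.
Proof. by rewrite /cnt fset_set1 cardfs1. Qed.

Lemma cntD1 (U : choiceType) (A : set U) (a : U) :
  finite_set A -> A a -> cnt A = (cnt (A `\ a)).+1.
Proof.
move=> finA Aa; rewrite -addn1 -(cnt1 a) -cntU //.
- by rewrite setUC setD1K.
- exact: finite_setD.
- by apply/seteqP; split=> // b [[_ /=]].
Qed.

End Counting.

(** * Subgroups and their right cosets *)

Section Subgroup.
Variables (F : groupType) (H : set F).
Hypothesis sgH : subgroup H.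

Lemma subgroup1 : H 1.
Proof. by have [] := sgH; rewrite inE. Qed.

Lemma subgroupV g : H g -> H g^-1.
Proof.
by move=> Hg; have := group_closedV sgH; move=> /(_ g); rewrite !inE; apply.
Qed.

Lemma subgroupM g h : H g -> H h -> H (g * h).
Proof.
by move=> Hg Hh; have := group_closedM sgH; move=> /(_ g h); rewrite !inE; apply.
Qed.

Lemma subgroupVE g : H g^-1 -> H g.
Proof. by move=> /subgroupV; rewrite invgK. Qed.

End Subgroup.

Lemma right_cosetE (F : groupType) (H : set F) g t :
  right_coset H g t <-> H (t * g^-1).
Proof.
split=> [[h Hh <-]|Ht]; first by rewrite mulgK.
by exists (t * g^-1); rewrite ?mulgVK.
Qed.

(** * Word length in a free group *)

Section Length.
Variables (F : groupType) (n : nat) (x : 'I_n -> F).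
Hypothesis hx : free_basis x [set: F].
Implicit Types (g h v : F) (w : word n) (a : 'I_n * bool).

Lemma basis_free : free_family x. Proof. by case: hx. Qed.

Lemma reduced_wordP v :
  reduced (reduced_word x v) /\ eval_word x (reduced_word x v) = v.
Proof.
rewrite /reduced_word; case: xgetP => [//|noword].
have : range (eval_word x) v by rewrite -generated_rangeE; case: hx => ->.
case=> w _ wv; case: (noword (red w)).
by split; [apply: freduced_red | rewrite eval_red].
Qed.

Lemma eval_reduced_word v : eval_word x (reduced_word x v) = v.
Proof. by case: (reduced_wordP v). Qed.

Lemma reduced_word_eval w : reduced_word x (eval_word x w) = red w.
Proof.
have [vR ev] := reduced_wordP (eval_word x w).
by rewrite -(red_id vR); apply: red_eval ev; apply: basis_free.
Qed.

Lemma len_eval w : (len x (eval_word x w) <= size w)%N.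
Proof. by rewrite /len reduced_word_eval size_red. Qed.

Lemma len_eval_reduced w : reduced w -> len x (eval_word x w) = size w.
Proof. by move=> wR; rewrite /len reduced_word_eval red_id. Qed.

Lemma len1 : len x 1 = 0%N.
Proof. by rewrite -(eval_nil x) len_eval_reduced. Qed.

Lemma lenM g h : (len x (g * h) <= len x g + len x h)%N.
Proof.
rewrite -{1}(eval_reduced_word g) -{1}(eval_reduced_word h) -eval_cat.
by rewrite (leq_trans (len_eval _)) // size_cat.
Qed.

Lemma lenV g : len x g^-1 = len x g.
Proof.
have lenV_le h : (len x h^-1 <= len x h)%N.
  by rewrite -{1}(eval_reduced_word h) -eval_winv -[leqRHS]size_winv len_eval.
by apply/eqP; rewrite eqn_leq lenV_le -{1}(invgK g) lenV_le.
Qed.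

Lemma len_letter a : (len x (letter x a) <= 1)%N.
Proof. by rewrite -[letter x a]mulg1 -(eval_nil x) -eval_cons len_eval. Qed.

Lemma finite_ball i : finite_set [set v | (len x v <= i)%N].
Proof.
apply: (sub_finite_set (B := range (fun w : i.-bseq ('I_n * bool) => eval_word x w))).
  move=> v /= vi; exists (Bseq vi) => //; exact: eval_reduced_word.
by apply: finite_image; apply: finite_finset.
Qed.

End Length.

(** * Schreier transversals as spanning trees, and their boundary vertices *)

Section Transversal.
Variables (F : groupType) (n : nat) (x : 'I_n -> F).
Hypothesis hx : free_basis x [set: F].
Variables (H T : set F).
Hypotheses (sgH : subgroup H) (trT : schreier_transversal x H T).
Implicit Types (g h t u v : F) (w : word n) (a : 'I_n * bool) (i : nat).

Lemma transversal1 : T 1. Proof. by case: trT. Qed.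

Lemma transversal_prefix w j : reduced w -> T (eval_word x w) ->
  T (eval_word x (take j w)).
Proof.
move=> wR; have [_ _ pre] := trT => /pre-/(_ j).
by rewrite (reduced_word_eval hx) red_id.
Qed.

Lemma transversal_rcons w a : reduced (rcons w a) ->
  T (eval_word x (rcons w a)) -> T (eval_word x w).
Proof.
move=> wR /(transversal_prefix (size w) wR).
by rewrite -cats1 take_size_cat.
Qed.

(** Vertices of the Schreier graph are named by their representatives in T; [rep g] is the end of
    the path labelled g from the root. *)
Definition rep g : F := xget 1 [set t | T t /\ right_coset H g t].

Lemma repP g : T (rep g) /\ H (rep g * g^-1).
Proof.
rewrite /rep; case: xgetP => [t _ [Tt /right_cosetE]//|none].
by have [/(_ g)[t [Ht _]] _ _] := trT; case: (none t).
Qed.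

Lemma rep_in g : T (rep g). Proof. by case: (repP g). Qed.

Lemma rep_unique g t : T t -> H (t * g^-1) -> rep g = t.
Proof.
move=> Tt Ht; have [/(_ g)[s [_ uniq]] _ _] := trT; have [Tr Hr] := repP g.
by rewrite -(uniq (rep g)) ?(uniq t) //; split=> //; apply/right_cosetE.
Qed.

Lemma rep_id t : T t -> rep t = t.
Proof. by move=> Tt; apply: rep_unique => //; rewrite mulgV; apply: subgroup1. Qed.

Lemma rep_eq g h : H (g * h^-1) -> rep g = rep h.
Proof.
move=> Hgh; apply: rep_unique; first exact: rep_in.
have [_ Hh] := repP h.
rewrite -[rep h](mulgVK h) -mulgA; apply: subgroupM => //.
by rewrite -invgF; apply: subgroupV.
Qed.

Lemma rep_mul g h : rep (rep g * h) = rep (g * h).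
Proof. by apply: rep_eq; rewrite invgM mulgA mulgK; case: (repP g). Qed.

(** The edge labelled a at u lies in the tree exactly when [u * letter x a] is itself in T. *)
Definition boundary i : set F :=
  [set u | [/\ T u, (len x u <= i)%N & exists a, ~ T (u * letter x a)]].

Lemma boundary_finite i : finite_set (boundary i).
Proof. by apply: sub_finite_set (finite_ball hx i) => u []. Qed.

Lemma boundary_le i j : (i <= j)%N -> boundary i `<=` boundary j.
Proof. by move=> ij u [Tu ui ex]; split=> //; apply: leq_trans ij. Qed.

(* The path labelled by g from the vertex v of the Schreier graph is closed but
   not null-homotopic, so it must leave the spanning tree T. *)
Lemma path_exits_transversal v g : T v -> g <> 1 -> H (v * g * v^-1) ->
  exists u, [/\ T u, exists a, ~ T (u * letter x a) &
    (len x (u^-1 * v) <= len x g)%N].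
Proof.
move=> Tv g1 Hg; pose w := reduced_word x g.
have wE : eval_word x w = g := eval_reduced_word hx g.
(* If v g were in T, it would represent the same coset as v, forcing v g = v and g = 1. The vertex
   just before the first exit is the one sought. *)
have ex_out : exists j, ~~ `[< T (v * eval_word x (take j w)) >].
  exists (size w); rewrite take_size wE; apply/negP => /asboolP Tvg; apply: g1.
  apply: (mulgI v); rewrite mulg1 -(rep_id Tvg) -[RHS](rep_id Tv).
  exact: rep_eq.
case: (ex_minnP ex_out) => -[|j] /asboolPn nT jmin.
  by case: nT; rewrite take0 eval_nil mulg1.
have /asboolP Tj : `[< T (v * eval_word x (take j w)) >].
  by apply/negPn/negP => /jmin; rewrite ltnn.
have jw : (j < size w)%N.
  by rewrite ltnNge; apply/negP => wj; apply: nT;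
     rewrite take_oversize ?(leq_trans wj) // -(take_oversize wj).
exists (v * eval_word x (take j w)); split=> //.
  have a : 'I_n * bool by case: (w) jw.
  exists (nth a w j).
  by rewrite -mulgA -eval_rcons -take_nth.
rewrite invgM mulgVK (lenV hx) (leq_trans (len_eval hx _)) //.
by rewrite size_take jw ltnW.
Qed.

(** Each v is determined by a boundary vertex u near it and the displacement [u^-1 * v], which
    ranges over the ball of radius L in F. *)
Lemma ball_growth_le_boundary L :
  (forall v, exists g, [/\ g <> 1, (len x g <= L)%N & H (v * g * v^-1)]) ->
  forall i, (ball_growth x T i <=
    cnt [set g | (len x g <= L)%N] * cnt (boundary (i + L)))%N.
Proof.
move=> exg i; pose B := [set g | (len x g <= L)%N].
have /choice[f fP] : forall v, exists u, T v ->
    [/\ T u, exists a, ~ T (u * letter x a) & (len x (u^-1 * v) <= L)%N].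
  move=> v; have [Tv|nTv] := pselect (T v); last by exists 1.
  have [g [g1 gL /(path_exits_transversal Tv g1)[u [Tu exa uv]]]] := exg v.
  by exists u => _; split=> //; apply: leq_trans gL.
rewrite /ball_growth -/(cnt _) mulnC -cntX; last 2 first.
- exact: boundary_finite.
- exact: finite_ball.
apply: (cnt_inj (f := fun v => (f v, (f v)^-1 * v))).
- apply: finite_setX; [exact: boundary_finite|exact: finite_ball].
- move=> v [Tv vi]; have [Tu exa uv] := fP v Tv; split => //=; split=> //.
  rewrite -[f v](mulVKg v) (leq_trans (lenM hx _ _)) // leq_add //.
  by rewrite -(lenV hx) invgM invgK.
- move=> v v' _ _ [-> ]; exact: mulgI.
Qed.

End Transversal.

(** * Edge counts in balls of the tree, and bounds on [r_growth] *)

Section RankFunction.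
Variables (F : groupType) (n : nat) (x : 'I_n -> F).
Hypothesis hx : free_basis x [set: F].
Variables (H T : set F).
Hypotheses (sgH : subgroup H) (trT : schreier_transversal x H T).
Implicit Types (g h t u v : F) (w : word n) (a : 'I_n * bool) (i : nat).

Definition tree_ball i : set F := [set v | T v /\ (len x v <= i)%N].

Lemma tree_ball_finite i : finite_set (tree_ball i).
Proof. by apply: sub_finite_set (finite_ball hx i) => u []. Qed.

Lemma tree_ball1 i : tree_ball i 1.
Proof. by split; [apply: transversal1 trT|rewrite len1]. Qed.

Lemma ball_growth_gt0 i : (0 < ball_growth x T i)%N.
Proof.
rewrite /ball_growth -/(cnt _) (cntD1 (a := 1)) //; first exact: tree_ball_finite.
exact: tree_ball1.
Qed.

Lemma ball_growth_le i j : (i <= j)%N ->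
  (ball_growth x T i <= ball_growth x T j)%N.
Proof.
move=> ij; apply: cnt_le; first exact: tree_ball_finite.
by move=> v [Tv vi]; split=> //; apply: leq_trans ij.
Qed.

Lemma ball_growthS i :
  ball_growth x T i.+1 = (ball_growth x T i + sphere_growth x T i.+1)%N.
Proof.
rewrite /ball_growth /sphere_growth -!/(cnt _) -cntU.
- congr cnt; apply/seteqP; split=> v /=.
    by move=> [Tv]; rewrite leq_eqVlt => /orP[/eqP|]; [right|left].
  by move=> [[Tv vi]|[Tv vi]]; split=> //; [apply: leq_trans vi _|rewrite vi].
- exact: tree_ball_finite.
- apply: sub_finite_set (tree_ball_finite i.+1) => v [Tv vi]; split=> //.
  by rewrite vi.
- by apply/seteqP; split=> // v [[_ vi] [_ vi1]]; rewrite vi1 ltnn in vi.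
Qed.

(** Dropping the last letter of the reduced word of v stays in T, by prefix closure. *)
Lemma transversal_parent v : T v -> v <> 1 ->
  exists u a, [/\ T u, u * letter x a = v & (len x u).+1 = len x v].
Proof.
move=> Tv v1; have [vR vE] := reduced_wordP hx v.
case/lastP E : (reduced_word x v) => [|w a].
  by case: v1; rewrite -vE E eval_nil.
rewrite E in vR vE; exists (eval_word x w), a; split.
- by apply: (transversal_rcons hx trT vR); rewrite vE.
- by rewrite -eval_rcons.
- by rewrite (len_eval_reduced hx (freduced_rconsl vR)) /len E size_rcons.
Qed.

(* Among the 2n edges at each vertex of the ball of radius i in the Schreier
   graph, those of the tree T lead either to one of the non-trivial vertices of
   the ball of radius i + 1 or from one of the ball of radius i to its parent. *)
Lemma boundary_count i :
  (cnt (boundary x T i) + ball_growth x T i.+1 + ball_growth x T i <=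
    n * 2 * ball_growth x T i + 2)%N.
Proof.
pose E := tree_ball i `*` [set: 'I_n * bool].
pose E1 := [set p | E p /\ ~ T (p.1 * letter x p.2)].
pose E2 := [set p | [/\ E p, T (p.1 * letter x p.2) &
  len x (p.1 * letter x p.2) = (len x p.1).+1]].
pose E3 := [set p | [/\ E p, T (p.1 * letter x p.2) &
  len x p.1 = (len x (p.1 * letter x p.2)).+1]].
have finE : finite_set E by apply: finite_setX; [exact: tree_ball_finite|].
have fin1 : finite_set E1 by apply: sub_finite_set finE => p [].
have fin2 : finite_set E2 by apply: sub_finite_set finE => p [].
have fin3 : finite_set E3 by apply: sub_finite_set finE => p [].
have D1 : (cnt (boundary x T i) <= cnt E1)%N.
  apply: (cnt_surj (f := fst)) => // u [Tu ui [a nT]].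
  by exists (u, a).
(* The successor accounts for the root, which is no vertex's child; in [D3] it appears again because
   the root has no parent. Together they give the final [+ 2]. *)
have D2 : (ball_growth x T i.+1 <= (cnt E2).+1)%N.
  rewrite /ball_growth -/(cnt _) (cntD1 (a := 1)) ?ltnS; last 2 first.
  - exact: tree_ball_finite.
  - exact: tree_ball1.
  apply: (cnt_surj (f := fun p => p.1 * letter x p.2)) => // v [[Tv vi] v1].
  have [u [a [Tu uv lu]]] := transversal_parent Tv v1.
  exists (u, a) => //; split => /=; rewrite ?uv //.
  by split=> //; split=> //=; rewrite -ltnS lu.
have D3 : (ball_growth x T i <= (cnt E3).+1)%N.
  rewrite /ball_growth -/(cnt _) (cntD1 (a := 1)) ?ltnS; last 2 first.
  - exact: tree_ball_finite.
  - exact: tree_ball1.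
  apply: (cnt_surj (f := fst)) => // v [[Tv vi] v1].
  have [u [a [Tu uv lu]]] := transversal_parent Tv v1.
  by exists (v, flip a) => //; split => /=; rewrite ?letter_flip -?uv ?mulgK ?uv.
have : (cnt (E1 `|` E2 `|` E3) <= cnt E)%N.
  by apply: cnt_le => // p [[[]|[]]|[]].
rewrite cntU ?finite_setU //; last first.
  apply/seteqP; split=> // p [[[_ nT]|[_ _ l2]] [_ Tp l3]] //.
  by move: l3; rewrite l2; lia.
rewrite cntU //; last by apply/seteqP; split=> // p [[_ nT] []].
have -> : cnt E = (ball_growth x T i * cnt [set: 'I_n * bool])%N.
  by apply: cntX; [apply: tree_ball_finite|apply: finite_finset].
have : (cnt [set: 'I_n * bool] <= n * 2)%N.
  by rewrite (leq_trans (cnt_finType _)) // card_prod card_ord card_bool.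
move/(leq_mul (leqnn (ball_growth x T i))); lia.
Qed.

(** Splitting the ball of radius i + 1 into the ball of radius i and a sphere turns [boundary_count]
    into the bound 2 + 2(n - 1)Γ(i) - γ(i + 1), which is twice r(i). *)
Lemma boundary_le_r_growth i :
  ((cnt (boundary x T i))%:R <= 2 * r_growth x T i :> rat)%R.
Proof.
have := boundary_count i; rewrite ball_growthS -(ler_nat rat) /r_growth.
rewrite !natrD !natrM; lra.
Qed.

Lemma r_growth_le i : (r_growth x T i <= n%:R * (ball_growth x T i)%:R)%R.
Proof.
rewrite /r_growth.
have : (1 <= (ball_growth x T i)%:R :> rat)%R by rewrite ler1n ball_growth_gt0.
have : (0 <= (sphere_growth x T i.+1)%:R :> rat)%R by apply: ler0n.
lra.
Qed.

Lemma growth_le_linear (f : nat -> rat) (c : nat) :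
  (forall i, (f i <= c%:R * (ball_growth x T i)%:R)%R) ->
  growth_le f (fun i => (ball_growth x T i)%:R%R).
Proof.
move=> fc; exists c.+1 => // i i1; apply: le_trans (fc i) _.
rewrite -!natrM ler_nat leq_mul // ball_growth_le //.
by rewrite mulSn leq_addr.
Qed.

(** The lower bound common to both parts: [f] will be [r_growth] with k = 0, and the rank-growth
    function with k = 3. *)
Lemma growth_le_boundary (f : nat -> rat) (L k : nat) :
  (forall v, exists g, [/\ g <> 1, (len x g <= L)%N & H (v * g * v^-1)]) ->
  (forall i, (0 < i)%N ->
     ((cnt (boundary x T i))%:R <= 2 * f (k.+1 * i)%N)%R) ->
  growth_le (fun i => (ball_growth x T i)%:R%R) f.
Proof.
move=> exg fD; pose C := cnt [set g | (len x g <= L)%N].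
(* The summand 2C covers the multiplicative loss, while 1 + L gives i + L <= c i for i >= 1. *)
pose c := ((2 * C).+1 + L)%N.
exists (k.+1 * c)%N => [|i i1]; first by rewrite muln_gt0.
have := ball_growth_le_boundary hx sgH trT exg i; rewrite -/C => le1.
have le2 : (cnt (boundary x T (i + L)) <= cnt (boundary x T (c * i)))%N.
  by apply: cnt_le; [exact: boundary_finite|apply: boundary_le; rewrite /c; nia].
have /fD : (0 < c * i)%N by rewrite muln_gt0.
rewrite mulnA; set r := f _ => le3.
have {le1 le2} : (ball_growth x T i <= C * cnt (boundary x T (c * i)))%N.
  by apply: leq_trans le1 _; rewrite leq_mul2l le2 orbT.
rewrite -(ler_nat rat) natrM => /le_trans; apply.
move: le3; set d := cnt _ => le3.
(* Non-negativity, needed to enlarge the factor 2C, comes from r bounding a cardinality. *)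
have r0 : (0 <= r)%R by have : (0 <= d%:R :> rat)%R := ler0n _ _; lra.
apply: (@le_trans _ _ ((2 * C)%:R * r)%R).
  by rewrite mulnC natrM -mulrA ler_wpM2l ?ler0n.
by rewrite ler_wpM2r // ler_nat /c; nia.
Qed.

End RankFunction.

(** * Supnormal subgroups: growth of [r_growth] *)

Lemma supnormal_conj (F : groupType) (n : nat) (x : 'I_n -> F) (H : set F) :
  supnormal H -> exists L, forall v,
    exists g, [/\ g <> 1, (len x g <= L)%N & H (v * g * v^-1)].
Proof.
move=> [_ [N [[_ Nconj] [h Nh h1] NH]]]; exists (len x h) => v.
(* A single h serves every v, since all its conjugates stay in N. *)
exists h; split=> //; apply: NH; rewrite -(Nconj v^-1).
by exists h => //; rewrite conjgE invgK mulgA.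
Qed.

Lemma r_growth_equiv (F : groupType) (n : nat) (x : 'I_n -> F) (H T : set F) :
  free_basis x [set: F] -> supnormal H -> schreier_transversal x H T ->
  growth_equiv (r_growth x T) (fun i => (ball_growth x T i)%:R%R).
Proof.
move=> hx supH trT; have [sgH _] := supH; split.
  by apply: (growth_le_linear hx (c := n)) => i; apply: (r_growth_le hx trT).
have [L HL] := supnormal_conj x supH.
apply: (growth_le_boundary hx sgH trT (k := 0%N) HL) => i _.
by rewrite mul1n; apply: (boundary_le_r_growth hx trT).
Qed.

(** * Invariance of the rank of a free group, by abelianization *)

Section RankInvariance.
Local Open Scope ring_scope.

(** The vector of exponent sums: the image of w in the rationalized abelianization. *)
Definition expo (k : nat) (w : word k) : 'rV[rat]_k :=
  \sum_(a <- w) (-1) ^+ a.2 *: delta_mx 0 a.1.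

Lemma expo_cons k (a : 'I_k * bool) w :
  expo (a :: w) = (-1) ^+ a.2 *: delta_mx 0 a.1 + expo w.
Proof. by rewrite /expo big_cons. Qed.

Lemma expo_cat k (u v : word k) : expo (u ++ v) = expo u + expo v.
Proof. by rewrite /expo big_cat. Qed.

Lemma expo_winv k (w : word k) : expo (winv w) = - expo w.
Proof.
elim: w => [|a w IH]; first by rewrite /expo big_nil oppr0.
rewrite winv_cons -cats1 expo_cat IH !expo_cons /expo big_nil addr0.
by rewrite opprD addrC /= signrN scaleNr.
Qed.

Lemma expo_red k (w : word k) : expo (red w) = expo w.
Proof.
elim: w => //= a w; rewrite expo_cons => <-.
case: (red w) => [|b s] /=; first by rewrite expo_cons.
case: eqP => [->|_]; last by rewrite expo_cons.
by rewrite expo_cons /= signrN scaleNr addNKr.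
Qed.

Variables (F : groupType) (k m : nat) (y : 'I_k -> F) (z : 'I_m -> F).

(** Rewriting y in z and back yields matrices with B M = 1 of size k, so k is at most the rank of M,
    which has m rows. *)
Lemma free_size_le : free_family y ->
  range y `<=` range (eval_word z) -> range z `<=` range (eval_word y) ->
  (k <= m)%N.
Proof.
move=> y_free yz zy.
have /choice[yw ywE] : forall i, exists w, eval_word z w = y i.
  by move=> i; have [|w _ <-] := yz (y i); [exists i|exists w].
have /choice[zw zwE] : forall j, exists w, eval_word y w = z j.
  by move=> j; have [|w _ <-] := zy (z j); [exists j|exists w].
pose M := \matrix_(j < m) expo (zw j).
have subst (u : word m) :
    exists w, eval_word y w = eval_word z u /\ expo w = expo u *m M.
  elim: u => [|a u [w [wu wM]]].
    by exists [::]; rewrite !eval_nil /expo !big_nil mul0mx.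
  exists ((if a.2 then winv (zw a.1) else zw a.1) ++ w).
  rewrite eval_cat eval_cons wu expo_cat expo_cons wM mulmxDl -scalemxAl.
  rewrite -rowE rowK /letter; case: ifP => _.
    by rewrite eval_winv zwE expo_winv scaleN1r.
  by rewrite zwE scale1r.
pose B := \matrix_(i < k) expo (yw i).
have BM : B *m M = 1%:M.
  apply/row_matrixP => i; rewrite row_mul rowK row1.
  have [w [wE <-]] := subst (yw i).
  (* Freeness of y makes the rewritten word reduce to the letter [y i], and reduction preserves
     exponent sums. *)
  have /(red_eval y_free) rw : eval_word y w = eval_word y [:: (i, false)].
    by rewrite wE ywE eval_cons eval_nil mulg1.
  rewrite -expo_red rw expo_red expo_cons /expo big_nil addr0 scale1r //.
by rewrite -{1}(mxrank1 rat k) -BM (leq_trans (mxrankM_maxr _ _)) ?rank_leq_row.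
Qed.

End RankInvariance.

Lemma rank_free_basis (F : groupType) (k : nat) (y : 'I_k -> F) (G : set F) :
  free_basis y G -> rank G = k.
Proof.
move=> [yG y_free]; rewrite /rank; case: xgetP => [m _ [z [zG z_free]]|none].
  have sub_range j (f : 'I_j -> F) : range f `<=` range (eval_word f).
    by rewrite -generated_rangeE; apply: sub_smallest.
  have yz : range (eval_word y) = range (eval_word z).
    by rewrite -!generated_rangeE yG zG.
  have yR : range y `<=` range (eval_word z) by rewrite -yz; apply: sub_range.
  have zR : range z `<=` range (eval_word y) by rewrite yz; apply: sub_range.
  by apply/eqP; rewrite eqn_leq (free_size_le z_free zR yR) (free_size_le y_free yR zR).
by case: (none k); exists y.
Qed.

(** * Schreier generators and their freeness *)

Section SchreierGenerators.
Variables (F : groupType) (n : nat) (x : 'I_n -> F).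
Hypothesis hx : free_basis x [set: F].
Variables (H T : set F).
Hypotheses (sgH : subgroup H) (trT : schreier_transversal x H T).
Implicit Types (g h t u v : F) (w s : word n) (a : 'I_n * bool) (i : nat).
Implicit Types (p : F * 'I_n).

Local Notation rep := (rep H T).

(** The loop that follows T to [p.1], crosses the edge labelled [x p.2], and returns to the root
    along T. *)
Definition sgen p : F := p.1 * x p.2 * (rep (p.1 * x p.2))^-1.

(** Only positive labels are used, so each edge is named once and not once per direction. *)
Definition nontree p : Prop := T p.1 /\ ~ T (p.1 * x p.2).

Lemma rep_letter_flip t a : T t ->
  rep (rep (t * letter x a) * letter x (flip a)) = t.
Proof.
by move=> Tt; rewrite letter_flip (rep_mul sgH trT) mulgK (rep_id sgH trT).
Qed.

Lemma nontree_flip t a : T t -> ~ T (t * letter x a) ->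
  ~ T (rep (t * letter x a) * letter x (flip a)).
Proof.
move=> Tt nT Tt'; apply: nT; rewrite -(rep_letter_flip a Tt).
rewrite (rep_id sgH trT Tt') letter_flip mulgVK; exact: rep_in trT _.
Qed.

(** An inverse letter crosses its edge backwards, so that edge is named by the vertex reached. *)
Definition label t a : seq ((F * 'I_n) * bool) :=
  if `[< T (t * letter x a) >] then [::]
  else [:: ((if a.2 then rep (t * letter x a) else t, a.1), a.2)].

(* Reading w along the Schreier graph from the vertex t, keep only the edges
   outside the spanning tree T. This is the rewriting map onto words in the
   Schreier generators. *)
Fixpoint trace t w : seq ((F * 'I_n) * bool) :=
  if w is a :: w' then label t a ++ trace (rep (t * letter x a)) w' else [::].

Lemma red_label_flip t a s : T t ->
  red (label t a ++ label (rep (t * letter x a)) (flip a) ++ trace t s) =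
  red (trace t s).
Proof.
move=> Tt; rewrite /label; case: asboolP => [Tta|nT].
  rewrite (rep_id sgH trT Tta) letter_flip mulgK.
  by case: asboolP.
case: asboolP => [/(nontree_flip Tt nT)//|_]; rewrite rep_letter_flip //=.
have := @red_cancel _ [::] (if a.2 then rep (t * letter x a) else t, a.1, a.2)
  (trace t s).
by rewrite /flip /=; case: (a.2).
Qed.

Lemma red_trace_rstep t a s : T t ->
  red (trace t (rstep a s)) = red (trace t (a :: s)).
Proof.
move=> Tt; case: s => [|b s] //=; case: eqP => // -> /=.
by rewrite (rep_letter_flip a Tt) red_label_flip.
Qed.

(** Crossing an edge and returning emits nothing inside T and a cancelling pair outside it, so
    tracing is compatible with free reduction. *)
Lemma red_trace t w : T t -> red (trace t (red w)) = red (trace t w).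
Proof.
elim: w t => // a w IH t Tt; rewrite [red (a :: w)]/= red_trace_rstep //=.
by apply: red_catr; apply: IH; apply: rep_in trT _.
Qed.

Lemma trace_forth w s : reduced w -> T (eval_word x w) ->
  trace 1 (w ++ s) = trace (eval_word x w) s.
Proof.
elim/last_ind: w s => [|w a IH] s; first by rewrite eval_nil.
move=> wR Tw; rewrite cat_rcons IH; last 2 first.
- exact: (freduced_rconsl wR).
- exact: (transversal_rcons hx trT wR Tw).
rewrite /= -eval_rcons (rep_id sgH trT Tw) /label -eval_rcons.
by case: asboolP.
Qed.

Lemma trace_back w s : reduced w -> T (eval_word x w) ->
  trace (eval_word x w) (winv w ++ s) = trace 1 s.
Proof.
elim/last_ind: w s => [|w a IH] s; first by rewrite eval_nil.
move=> wR Tw; have Tw' := transversal_rcons hx trT wR Tw.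
rewrite winv_rcons /= /label eval_rcons letter_flip mulgK (rep_id sgH trT Tw').
by case: asboolP => // _; apply: IH => //; apply: freduced_rconsl wR.
Qed.

Definition sgen_word p (b : bool) : word n :=
  let t' := rep (p.1 * x p.2) in
  if b then reduced_word x t' ++ (p.2, true) :: winv (reduced_word x p.1)
  else reduced_word x p.1 ++ (p.2, false) :: winv (reduced_word x t').

Lemma eval_sgen_word p b :
  eval_word x (sgen_word p b) = if b then (sgen p)^-1 else sgen p.
Proof.
rewrite /sgen_word /sgen; case: b;
rewrite eval_cat eval_cons eval_winv !(eval_reduced_word hx) /letter /= mulgA //.
by rewrite !invgM invgK mulgA.
Qed.

(** The outward and return journeys run inside T, so only the crossing of p is recorded. *)
Lemma trace_sgen_word p b s : nontree p ->
  trace 1 (sgen_word p b ++ s) = (p, b) :: trace 1 s.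
Proof.
case: p => t k [/= Tt nT]; pose a : 'I_n * bool := (k, false).
have Tt' := rep_in trT (t * x k).
have [tR tE] := reduced_wordP hx t.
have [t'R t'E] := reduced_wordP hx (rep (t * x k)).
rewrite /sgen_word /=; case: b; rewrite -catA /= trace_forth ?tE ?t'E //=.
  have E : rep (rep (t * x k) * letter x (k, true)) = t := rep_letter_flip a Tt.
  have nT' := @nontree_flip t a Tt nT; rewrite /label; case: asboolP => // _.
  by rewrite /= E; have := trace_back s tR; rewrite tE => ->.
rewrite /label /letter /=; case: asboolP => // _.
by have := trace_back s t'R; rewrite t'E /= => ->.
Qed.

(** Spelling a relation w out in the basis gives a word v that reduces to the empty word and whose
    trace is w relabelled by e. This trace is already reduced, as e is injective, hence empty. *)
Lemma sgen_free m (e : 'I_m -> F * 'I_n) :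
  injective e -> (forall j, nontree (e j)) -> free_family (sgen \o e).
Proof.
move=> e_inj e_nt w wR w1.
have [v [vE vT]] : exists v : word n, eval_word x v = eval_word (sgen \o e) w /\
    trace 1 v = [seq (e b.1, b.2) | b <- w].
  elim: w {wR w1} => [|a w [v [vE vT]]] /=; first by exists [::]; rewrite !eval_nil.
  exists (sgen_word (e a.1) a.2 ++ v).
  by rewrite trace_sgen_word // vT eval_cat eval_sgen_word vE eval_cons.
have rv : red v = [::].
  by apply: (red_eval1 (basis_free hx)); rewrite vE.
have := red_trace v (transversal1 trT); rewrite rv vT [RHS]red_id.
  by case: (w).
rewrite /freduced sorted_map; apply: sub_sorted wR => -[j b] [j' b'] /=.
by apply: contraNneq => -[/e_inj-> ->].
Qed.

End SchreierGenerators.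

(** * The rank-growth function as a count of edges outside a minimal transversal *)

Section RankGrowth.
Variables (F : groupType) (n : nat) (x : 'I_n -> F).
Hypothesis hx : free_basis x [set: F].
Variables (H T : set F).
Hypotheses (sgH : subgroup H) (minT : minimal_schreier_transversal x H T).
Implicit Types (g h t u v : F) (w s : word n) (a : 'I_n * bool) (i : nat).
Implicit Types (p : F * 'I_n).

Local Notation rep := (rep H T).

Let trT : schreier_transversal x H T. Proof. by case: minT. Qed.

(** Strict inequality leaves room for the crossed letter, so the corresponding loops have length at
    most i. *)
Definition short_nontree i : set (F * 'I_n) :=
  [set p | nontree x T p /\ (len x p.1 + len x (rep (p.1 * x p.2)) < i)%N].

Lemma short_nontree_sub i :
  short_nontree i `<=` tree_ball x T i `*` [set: 'I_n].
Proof. by move=> p [[Tp _] pi]; split=> //; split=> //; lia. Qed.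

Lemma short_nontree_finite i : finite_set (short_nontree i).
Proof.
apply: sub_finite_set (@short_nontree_sub i) _.
by apply: finite_setX; [apply: tree_ball_finite hx _ _|apply: finite_finset].
Qed.

Lemma short_nontree_le i j : (i <= j)%N -> short_nontree i `<=` short_nontree j.
Proof. by move=> ij p [nt pi]; split=> //; apply: leq_trans ij. Qed.

Lemma len_rep_le g h : H (h * g^-1) -> (len x (rep g) <= len x h)%N.
Proof.
move=> Hhg; have [_ min] := minT; apply: min (rep_in trT g) _.
apply/right_cosetE; rewrite -(rep_eq sgH trT Hhg).
have [_ Hr] := repP trT h; apply: (subgroupVE sgH).
by rewrite invgF.
Qed.

(** The Schreier generators of the short edges are a free basis of [H_i]: free by [sgen_free],
    generating by telescoping each h of length at most i. *)
Lemma rank_growthE i : rank_growth x H i = cnt (short_nontree i).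
Proof.
pose X := fset_set (short_nontree i); pose m := size (enum_fset X).
pose e (j : 'I_m) := tnth (in_tuple (enum_fset X)) j.
have e_inj : injective e by apply/tuple_uniqP; apply: fset_uniq.
have eX j : short_nontree i (e j).
  have := mem_tnth j (in_tuple (enum_fset X)); rewrite -/(e j) => /= ejX.
  have : e j \in X by exact: ejX.
  by rewrite in_fset_set ?inE //; apply: short_nontree_finite.
have Xe p : short_nontree i p -> exists j, e j = p.
  move=> ip; have : p \in X.
    by rewrite in_fset_set ?inE //; apply: short_nontree_finite.
  by move=> /(tnthP (in_tuple (enum_fset X)))[j ->]; exists j.
pose y := sgen x H T \o e.
suff yH : free_basis y (generated [set h | H h /\ (len x h <= i)%N]).
  exact: rank_free_basis yH.
split; last by apply: (sgen_free hx sgH trT) => // j; have [] := eX j.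
rewrite generated_rangeE; apply/seteqP; split.
  rewrite -generated_rangeE => g gY K [sgK HK]; apply: gY; split=> //.
  apply: subset_trans HK.
  move=> _ [j _ <-]; rewrite /y /sgen /=; have [_ ji] := eX j; split.
    have [_ Hr] := repP trT ((e j).1 * x (e j).2).
    by apply: (subgroupVE sgH); rewrite invgF.
  rewrite (leq_trans (lenM hx _ _)) // (lenV hx).
  have := lenM hx (e j).1 (x (e j).2); have := len_letter hx ((e j).2, false).
  rewrite /letter /=; lia.
have sgY := subgroup_range_eval y.
apply: smallest_sub => // h [Hh hi].
set G := range (eval_word y) in sgY *.
have Gsgen p : short_nontree i p -> G (sgen x H T p).
  move=> /Xe[j <-]; exists [:: (j, false)] => //.
  by rewrite eval_cons eval_nil mulg1.
pose w := reduced_word x h.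
have wh : eval_word x w = h := eval_reduced_word hx h.
(* Telescoping: the step from u to u a contributes rep(u) a rep(u a)^-1, and
   minimality of T bounds the lengths of rep(u) and rep(u a) by those of u and
   of the rest of the word respectively. *)
have G_suffix (s u : word n) : u ++ s = w -> G (rep (eval_word x u) * eval_word x s).
  elim: s u => [|a s IH] u.
    rewrite cats0 => ->; rewrite wh eval_nil mulg1.
    rewrite (rep_unique trT (t := 1)); first exact: subgroup1 sgY.
      exact: transversal1 trT.
    by rewrite mul1g; apply: subgroupV.
  move=> uasw; have := IH (rcons u a); rewrite cat_rcons => /(_ uasw) Gs.
  set t := rep (eval_word x u); set t' := rep (eval_word x (rcons u a)) in Gs.
  have Tt : T t := rep_in trT _.
  have t'E : t' = rep (t * letter x a).
    by rewrite /t' eval_rcons (rep_mul sgH trT).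
  rewrite eval_cons mulgA -(mulgVK t' (t * letter x a)) -mulgA.
  apply: (subgroupM sgY) Gs.
  have tu : (len x t <= size u)%N.
    apply: (leq_trans _ (len_eval hx u)); apply: len_rep_le.
    by rewrite mulgV; apply: subgroup1.
  (* Since u a s lies in H, the elements u a and s^-1 lie in the same right coset. *)
  have t's : (len x t' <= size s)%N.
    apply: (leq_trans _ (len_eval hx s)).
    rewrite -[leqRHS](lenV hx); apply: len_rep_le.
    apply: (subgroupVE sgH); rewrite invgM !invgK -eval_cat cat_rcons uasw wh.
    exact: Hh.
  have usi : (size u + size s < i)%N.
    by have : size (u ++ a :: s) = len x h; [rewrite uasw | rewrite size_cat /=; lia].
  have [Tta|nT] := pselect (T (t * letter x a)).
    rewrite t'E (rep_id sgH trT Tta) mulgV; exact: subgroup1 sgY.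
  clearbody t'; case: a t'E nT {uasw} => k [] t'E nT.
    (* For an inverse letter the contribution is the inverse of the generator of the edge starting
       at [t']. *)
    have tE : rep (t' * x k) = t.
      by rewrite t'E; apply: (rep_letter_flip sgH trT (k, true) Tt).
    apply: (subgroupVE sgY); have -> : (t * letter x (k, true) * t'^-1)^-1 =
        sgen x H T (t', k).
      by rewrite /sgen /= tE /letter /= !invgM !invgK mulgA.
    apply: Gsgen; split; last by rewrite /= tE; lia.
    rewrite /nontree /= t'E; split; first exact: rep_in trT _.
    by apply: (@nontree_flip _ _ _ _ _ sgH trT t (k, true)).
  have := Gsgen (t, k); rewrite /sgen /= t'E; apply.
  by split; [split | rewrite /= -[x k]/(letter x (k, false)) -t'E; lia].
have := G_suffix w [::] erefl.
by rewrite eval_nil (rep_id sgH trT (transversal1 trT)) mul1g wh.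
Qed.

Lemma rank_growth_le i : (rank_growth x H i <= n * ball_growth x T i)%N.
Proof.
rewrite rank_growthE mulnC; apply: leq_trans (cnt_le _ (@short_nontree_sub i)) _.
  by apply: finite_setX; [apply: tree_ball_finite hx _ _|apply: finite_finset].
rewrite cntX; [|exact: (tree_ball_finite hx)|exact: finite_finset].
by rewrite leq_mul2l (leq_trans (cnt_finType _)) ?orbT ?card_ord.
Qed.

(** A boundary vertex is one of the two ends of an edge outside T, whence the factor 2 and the
    boolean. The ends have lengths at most i and i + 1, with sum below 2i + 2. *)
Lemma boundary_le_rank_growth i :
  (cnt (boundary x T i) <= 2 * rank_growth x H (2 * i + 2))%N.
Proof.
rewrite rank_growthE; set E := short_nontree _.
have finE : finite_set E := short_nontree_finite _.
apply: (@leq_trans (cnt (E `*` [set: bool]))).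
  apply: (cnt_surj (f := fun pb : F * 'I_n * bool =>
      if pb.2 then rep (pb.1.1 * x pb.1.2) else pb.1.1)).
    by apply: finite_setX => //; apply: finite_finset.
  move=> u [Tu ui [[k b] nT]].
  have lr : (len x (rep (u * letter x (k, b))) <= i.+1)%N.
    apply: leq_trans (_ : len x (u * letter x (k, b)) <= _)%N.
      by apply: len_rep_le; rewrite mulgV; apply: subgroup1.
    rewrite (leq_trans (lenM hx _ _)) // -addn1 leq_add //; exact: len_letter hx _.
  case: b nT lr => nT lr.
    set t := rep _ in lr; have tu : rep (t * x k) = u.
      exact: (rep_letter_flip sgH trT (k, true) Tu).
    exists (t, k, true) => //=; split=> //; split => /=; last by rewrite tu; lia.
    split; first exact: rep_in trT _.
    exact: (@nontree_flip _ _ _ _ _ sgH trT u (k, true)).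
  exists (u, k, false) => //=.
  split=> //; split; [by split|].
  by apply: leq_ltn_trans (leq_add ui lr) _; lia.
rewrite cntX //; last exact: finite_finset.
by rewrite mulnC leq_mul2r (leq_trans (cnt_finType _)) ?orbT ?card_bool.
Qed.

Lemma rank_growth_mono i j : (i <= j)%N ->
  (rank_growth x H i <= rank_growth x H j)%N.
Proof.
move=> ij; rewrite !rank_growthE; apply: cnt_le (short_nontree_finite _) _.
exact: short_nontree_le.
Qed.

End RankGrowth.

(** * Existence of a minimal Schreier transversal, by shortlex order *)

Section MinimalTransversal.
Variables (F : groupType) (n : nat) (x : 'I_n -> F).
Hypothesis hx : free_basis x [set: F].
Variable H : set F.
Hypothesis sgH : subgroup H.
Implicit Types (u v w : word n) (a b : 'I_n * bool).

(** Digits start at 1: a zero digit would make a leading letter invisible in the key. *)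
Definition digit a : nat := (a.1 * 2 + a.2).+1.

(* Bijective base 2n + 1 numeration, which orders words in shortlex order. *)
Definition key w : nat := foldl (fun c a => c * (2 * n).+1 + digit a)%N 0%N w.

Lemma digit_lt a : (digit a < (2 * n).+1)%N.
Proof. by case: a => i b; rewrite /digit /=; have := ltn_ord i; case: b; lia. Qed.

Lemma digit_inj : injective digit.
Proof.
move=> [i b] [j c]; rewrite /digit /= => E.
have ij : i = j by apply: val_inj; move: E; case: b; case: c => /=; lia.
by rewrite ij in E *; move: E; case: b; case: c => //=; lia.
Qed.

Lemma key_rcons w a : key (rcons w a) = (key w * (2 * n).+1 + digit a)%N.
Proof. by rewrite /key -cats1 foldl_cat. Qed.

Lemma key_inj : injective key.
Proof.
elim/last_ind => [|u a IH] v; case/lastP: v => [|v b] //.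
- by rewrite key_rcons /digit /key /=; lia.
- by rewrite key_rcons /digit /key /=; lia.
rewrite !key_rcons => E.
have /digit_inj ab : digit a = digit b.
  by have := congr1 (modn^~ (2 * n).+1) E; rewrite !modnMDl !modn_small ?digit_lt.
rewrite ab in E *; congr rcons; apply: IH.
by move: E => /addIn/eqP; rewrite eqn_pmul2r // => /eqP.
Qed.

Lemma key_lt_rcons u v a b : (key u < key v)%N ->
  (key (rcons u a) < key (rcons v b))%N.
Proof. by rewrite !key_rcons => uv; have := digit_lt a; nia. Qed.

Lemma key_lt_size u v : (size u < size v)%N -> (key u < key v)%N.
Proof.
elim/last_ind: v u => // v b IH u; case/lastP: u => [|u a].
  by rewrite key_rcons /digit /key /=; lia.
rewrite !size_rcons ltnS => /IH; exact: key_lt_rcons.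
Qed.

Definition key_minimal w : Prop :=
  forall v, H (eval_word x v * (eval_word x w)^-1) -> (key w <= key v)%N.

(** A smaller word in the coset of w, with a appended, would beat [rcons w a]. *)
Lemma key_minimal_rcons w a : key_minimal (rcons w a) -> key_minimal w.
Proof.
move=> wmin v Hv; rewrite leqNgt; apply/negP => /(@key_lt_rcons _ _ a a).
rewrite ltnNge => /negP; apply; apply: wmin.
by rewrite !eval_rcons invgM mulgA mulgK.
Qed.

Lemma key_minimal_take w j : key_minimal w -> key_minimal (take j w).
Proof.
elim/last_ind: w => // w a IH wmin; have [jw|wj] := ltnP (size w) j.
  by rewrite take_oversize // size_rcons.
by rewrite -cats1 takel_cat //; apply: IH; apply: key_minimal_rcons wmin.
Qed.

Lemma red_id_size w : (size w <= size (red w))%N -> red w = w.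
Proof.
elim: w => //= a w IH; have := size_red w.
case E : (red w) IH => [|b s] /= IH wb.
  by case: w E IH wb => // c w E IH wb; rewrite E /= ltnS in wb.
case: eqP => [_|_] /= sw; first by lia.
by rewrite IH.
Qed.

Lemma key_minimal_reduced w : key_minimal w -> red w = w.
Proof.
move=> wmin; apply: red_id_size; rewrite leqNgt; apply/negP => /key_lt_size.
rewrite ltnNge => /negP; apply; apply: wmin.
by rewrite eval_red mulgV; apply: subgroup1.
Qed.

(** Take the word of least key in each coset: injectivity of [key] makes it unique, prefixes inherit
    minimality, and [key] refines length. *)
Lemma exists_minimal_transversal :
  exists T, minimal_schreier_transversal x H T.
Proof.
exists [set eval_word x w | w in key_minimal]; split; first split.
- move=> g; pose P m := `[< exists2 w, key w = m & H (eval_word x w * g^-1) >].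
  have exP : exists m, P m.
    exists (key (reduced_word x g)); apply/asboolP; exists (reduced_word x g) => //.
    by rewrite (eval_reduced_word hx) mulgV; apply: subgroup1.
  case: (ex_minnP exP) => m /asboolP[w wm Hw] mmin.
  have coset v : H (eval_word x v * g^-1) -> (key w <= key v)%N.
    by move=> Hv; rewrite wm; apply: mmin; apply/asboolP; exists v.
  exists (eval_word x w); split.
    split; last exact/right_cosetE.
    exists w => // v Hv; apply: coset; rewrite -[eval_word x v](mulgVK (eval_word x w)).
    by rewrite -mulgA; apply: subgroupM.
  move=> _ [[v vmin <-] /right_cosetE Hv]; congr eval_word; apply: key_inj.
  apply/eqP; rewrite eqn_leq coset // vmin //.
  rewrite -[eval_word x w](mulgVK g) -mulgA; apply: subgroupM => //.
  by rewrite -invgF; apply: subgroupV.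
- by exists [::]; rewrite ?eval_nil.
- move=> _ j [w wmin <-]; rewrite (reduced_word_eval hx) key_minimal_reduced //.
  by exists (take j w) => //; apply: key_minimal_take.
move=> _ g [w wmin <-] /right_cosetE Hg.
rewrite {1}/len (reduced_word_eval hx) key_minimal_reduced // leqNgt.
apply/negP => /key_lt_size; rewrite ltnNge => /negP; apply; apply: wmin.
by rewrite (eval_reduced_word hx).
Qed.

End MinimalTransversal.

(** * Normalizers of finite index: rank growth and cogrowth *)

Lemma finite_index_conj (F : groupType) (n : nat) (x : 'I_n -> F) (H A : set F) :
  A `<=` H -> nontrivial A -> finite_index (normalizer A) ->
  exists L, forall v,
    exists g, [/\ g <> 1, (len x g <= L)%N & H (v * g * v^-1)].
Proof.
move=> AH [a Aa a1]; pose N := normalizer A; rewrite /finite_index => finN.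
pose r C := xget 1 [set g | right_coset N g = C].
have rP g : right_coset N (r (right_coset N g)) = right_coset N g.
  by rewrite /r; case: xgetP => [C _ //|/(_ g)[]].
(* L is the maximal length of the conjugates of a by one chosen representative of each of the
   finitely many cosets of N. *)
have [L LP] : exists L, forall C, range (right_coset N) C ->
    (len x (a ^ r C) <= L)%N.
  have [s sE] := (finite_seqP _).1 finN; exists (\max_(C <- s) len x (a ^ r C)).
  by move=> C; rewrite sE /= => Cs; apply: (@leq_bigmax_seq _ s xpredT (fun C => len x (a ^ r C))).
exists L => v; pose g := r (right_coset N v); exists (a ^ g); split.
- by move=> /eqP; rewrite conjg_eq1 => /eqP.
- by apply: LP; exists v.
have Nv : right_coset N g v.
  rewrite rP; exists 1; last by rewrite mul1g.
  by rewrite /N /normalizer /= /conj_set; apply/seteqP; split=> [_ [h Ah <-]|h Ah];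
     [rewrite conjg1|exists h; rewrite ?conjg1].
(* Write v = m g with m normalizing A, and a = h ^ m with h in A; conjugating [a ^ g] back by v
   returns h. *)
case: Nv => m Nm <-; apply: AH; have := Aa; rewrite -{1}Nm => -[h Ah <-].
have -> : m * g * ((h ^ m) ^ g) * (m * g)^-1 = h.
  by rewrite -conjgM (conjgCV (m * g)) conjgK mulgK.
exact: Ah.
Qed.

Lemma rank_growth_equiv (F : groupType) (n : nat) (x : 'I_n -> F) (H A : set F) :
  free_basis x [set: F] -> subgroup H ->
  A `<=` H -> nontrivial A -> finite_index (normalizer A) ->
  growth_equiv (fun i => (rank_growth x H i)%:R%R)
               (fun i => (cogrowth x H i)%:R%R).
Proof.
move=> hx sgH AH ntA finN; rewrite /cogrowth; set T := xget _ _.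
(* Existence rules out the default [set0] of [xget]. *)
have minT : minimal_schreier_transversal x H T.
  rewrite /T; case: xgetP => // none.
  by have [T' /none] := exists_minimal_transversal hx sgH.
have [trT _] := minT; split.
  apply: (growth_le_linear hx (c := n)) => i.
  by rewrite -natrM ler_nat; apply: (rank_growth_le hx sgH minT).
have [L HL] := finite_index_conj x AH ntA finN.
apply: (growth_le_boundary hx sgH trT (k := 3) HL) => i i0.
rewrite -(natrM _ 2) ler_nat.
apply: leq_trans (boundary_le_rank_growth hx sgH minT i) _.
(* The choice k = 3 works because 2i + 2 <= 4i for i >= 1. *)
by rewrite leq_mul2l (rank_growth_mono hx sgH minT) //; lia.
Qed.

Theorem theorem3p1 (n : nat) (F : groupType) (x : 'I_n -> F)
    (hx : free_basis x [set: F]) :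
  (forall H T : set F,
     supnormal H -> schreier_transversal x H T ->
     growth_equiv (r_growth x T) (fun i => (ball_growth x T i)%:R%R)) /\
  (forall H : set F,
     subgroup H ->
     (exists A : set F,
        [/\ subgroup A, A `<=` H, nontrivial A & finite_index (normalizer A)]) ->
     growth_equiv (fun i => (rank_growth x H i)%:R%R)
                  (fun i => (cogrowth x H i)%:R%R)).
Proof.
split=> [H T|H sgH [A [_ AH ntA finN]]]; first exact: r_growth_equiv.
exact: rank_growth_equiv finN.
Qed.
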